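(* Fix an integer $t\ge 2$. There exists $k_0=k_0(t)$ such that the following holds for all integers $k\ge k_0$ and $n\ge 16t^2k^2$. Let $\mathcal F\subset\binom{[n]}{k}$ satisfy $$|\mathcal F|\ge \binom{n-1}{k-1}-\binom{n-k-1}{k-1}+2 .$$ Then either $d(\mathcal F)\ge \big(1-\frac1t\big)|\mathcal F|$, or there exists a set $S\subset[n]$ with $|S|\le t$ such that $|\mathcal F(\bar S)|\le \binom{n-4}{k-4}$ and, moreover, $|\mathcal F(x)|\ge k^{-1/2}|\mathcal F|$ for every $x\in S$.
   Context: $\binom{[n]}{k}$ denotes the family of all $k$-element subsets of $[n]=\{1,\dots,n\}$. The Kneser graph $KG(n,k)$ has vertex set $\binom{[n]}{k}$, two sets being adjacent iff they are disjoint. For $\mathcal F\subset\binom{[n]}{k}$, $d(\mathcal F)$ is the maximum degree of the subgraph of $KG(n,k)$ induced on $\mathcal F$, i.e. $d(\mathcal F)=\max_{F\in\mathcal F}|\{G\in\mathcal F: G\cap F=\emptyset\}|$. For $P\subset[n]$, $\mathcal F(P)=\{F\setminus P: P\subset F\in\mathcal F\}$ and $\mathcal F(\bar P)=\{F\in\mathcal F: F\cap P=\emptyset\}$; for $x\in[n]$, $\mathcal F(x)=\mathcal F(\{x\})$. The quantity $\binom{n-1}{k-1}-\binom{n-k-1}{k-1}+2$ is the size of the family $\mathcal D=\mathcal H(x,F)\cup\{F'\}$, where $x\notin F$, $x\in F'$, $F\cap F'=\emptyset$, and $\mathcal H(x,F)=\{F\}\cup\{A\in\binom{[n]}{k}: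 x\in A, A\cap F\ne\emptyset\}$. *)

(* Defs.v *)
(* The ground set [n] is represented by 'I_n = {0, ..., n-1}. *)
From mathcomp Require Import all_boot all_order all_algebra.

Set Implicit Arguments.
Unset Strict Implicit.
Unset Printing Implicit Defensive.

Definition ksets (n k : nat) : {set {set 'I_n}} := [set A : {set 'I_n} | #|A| == k].

(* The Kneser graph KG(n, k), as an adjacency relation on all subsets of [n];
   sets that are not of size k are isolated. It is irreflexive for k > 0. *)
Definition kneser (n k : nat) : rel {set 'I_n} :=
  fun A B => [&& A \in ksets n k, B \in ksets n k & [disjoint A & B]].
Arguments kneser : clear implicits.

(* Maximum degree of the subgraph of e induced on V (0 if V is empty). *)
Definition induced_max_degree (T : finType) (e : rel T) (V : {set T}) : nat :=
  \max_(x in V) #|[set y in V | e x y]|.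

(* F(P) *)
Definition link (n : nat) (F : {set {set 'I_n}}) (P : {set 'I_n}) :
  {set {set 'I_n}} := [set A :\: P | A in F & P \subset A].

(* F(\bar P) *)
Definition avoiding (n : nat) (F : {set {set 'I_n}}) (P : {set 'I_n}) :
  {set {set 'I_n}} := [set A in F | A :&: P == set0].

(* Main.v *)
(* Suppose that every member of F meets more than |F|/t members of F. If G is a
   subfamily of F with more than C(n-4,k-4) members and P is a maximal set with
   |G| <= r^|P| |G[P]|, where G[P] = {A in G : P \subset A} and r = 8t^2k, then
   |P| = O(log k) and G[P] is r-spread. Averaging over G[P] the number of members
   of F that are met shows that the degrees of the elements of P add up to at
   least (1 - 1/(8t))|F|/t.

   Let S be the set of elements of degree at least |F|/m, where m is of order
   sqrt k. If more than C(n-4,k-4) members avoided S, the above would give a set P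
   disjoint from S with O(log k) elements, whose degrees add up to too little.
   For x in S, the members of F that meet S exactly in x form a large family,
   because codegrees are at most C(n-2,k-2) <= 2|F|/k; the corresponding P contains
   no element of S other than x, so x itself has degree close to |F|/t. As
   codegrees are small, there are at most t such x. *)
Require Import Defs.
From mathcomp Require Import all_boot all_order all_algebra.
From mathcomp Require Import zify.
Set Implicit Arguments.
Unset Strict Implicit.
Unset Printing Implicit Defensive.

Import Order.TTheory GRing.Theory Num.Theory.

(* The members of F containing P; unlike in F(P), the elements of P are kept. *)
Definition star {n : nat} (F : {set {set 'I_n}}) (P : {set 'I_n}) :
  {set {set 'I_n}} := [set A in F | P \subset A].

Definition meeting {n : nat} (F : {set {set 'I_n}}) (P : {set 'I_n}) :
  {set {set 'I_n}} := [set A in F | A :&: P != set0].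

Definition trace {n : nat} (F : {set {set 'I_n}}) (A : {set 'I_n}) (x : 'I_n) :
  {set {set 'I_n}} := [set B in F | B :&: A == [set x]].

(** * Estimates for exponentials and binomial coefficients *)

Lemma linear_le_exp2 (a b : nat) :
  exists j0, forall j, j0 <= j -> a * j + b <= 2 ^ j.
Proof.
pose s := a + b; have [a_s b_s] : a <= s /\ b <= s by rewrite leq_addr leq_addl.
have s_lt : s.+1 <= 2 ^ s by rewrite ltn_expl.
exists (3 * s); elim=> [|j IHj] hj; first by nia.
have [hj'|hj'] := leqP (3 * s) j.
  have := IHj hj'; rewrite expnS.
  have : s < 2 ^ j by apply: leq_trans s_lt _; rewrite leq_exp2l //; lia.
  lia.
have -> : j.+1 = s * 3 by lia.
rewrite expnM.
have : s.+1 ^ 3 <= (2 ^ s) ^ 3 by rewrite leq_exp2r.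
rewrite !expnS !expn0; nia.
Qed.

(** By Pascal's rule the difference of the two binomials is a sum of [i] terms, each at most
    ['C(N.-1, j)]; [bin_sub_le] bounds the same terms from below. *)
Lemma bin_sub_ge (N i j : nat) : i <= N ->
  'C(N, j.+1) <= 'C(N - i, j.+1) + i * 'C(N.-1, j).
Proof.
elim: i => [|i IHi] hi; first by rewrite subn0; lia.
have := IHi (ltnW hi).
have -> : N - i = (N - i.+1).+1 by lia.
rewrite binS mulSn.
have : 'C(N - i.+1, j) <= 'C(N.-1, j) by apply: leq_bin2l; lia.
lia.
Qed.

Lemma bin_sub_le (N i j : nat) : i <= N ->
  'C(N - i, j.+1) + i * 'C(N - i, j) <= 'C(N, j.+1).
Proof.
elim: i => [|i IHi] hi; first by rewrite subn0; lia.
have := IHi (ltnW hi).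
have -> : N - i = (N - i.+1).+1 by lia.
rewrite binS mulSn.
have : 'C(N - i.+1, j) <= 'C((N - i.+1).+1, j) by apply: leq_bin2l; lia.
nia.
Qed.

Lemma bin_diag_le (n k p : nat) : p < k -> k <= n ->
  n * 'C(n - p.+1, k - p.+1) <= k * 'C(n - p, k - p).
Proof.
move=> pk kn; have := mul_bin_diag (n - p) (k - p.+1).
have -> : (n - p).-1 = n - p.+1 by lia.
have -> : (k - p.+1).+1 = k - p by lia.
set a := 'C(_, _); set b := 'C(_, _) => E.
rewrite -(@leq_pmul2l (n - p)); last lia.
have -> : (n - p) * (n * a) = n * ((k - p) * b) by rewrite -E; lia.
have h : n * (k - p) <= (n - p) * k by nia.
by rewrite !mulnA leq_mul2r h orbT.
Qed.

Lemma bin_diag_iter (n k p i w : nat) :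
  p + i <= k -> 0 < k -> k <= n -> w * k <= n ->
  w ^ i * 'C(n - (p + i), k - (p + i)) <= 'C(n - p, k - p).
Proof.
elim: i => [|i IHi] pik k0 kn wkn; first by rewrite addn0 expn0 mul1n.
apply: leq_trans (IHi _ k0 kn wkn); last lia.
rewrite expnSr -mulnA leq_mul2l addnS; apply/orP; right.
have := @bin_diag_le n k (p + i) _ kn.
move/(_ ltac:(lia)).
set a := 'C(_, _); set b := 'C(_, _) => h.
rewrite -(@leq_pmul2l k) //; apply: leq_trans h.
by rewrite mulnA leq_mul2r mulnC wkn orbT.
Qed.

(** The difference on the right is at least [k * 'C(n - k - 1, k - 2)], and this last binomial is at
    least half of ['C(n - 2, k - 2)] because n is at least 2k^2. *)
Lemma size_bound (n k : nat) : 2 < k -> 2 * k ^ 2 <= n ->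
  k * 'C(n - 2, k - 2) <= 2 * ('C(n - 1, k - 1) - 'C(n - k - 1, k - 1)).
Proof.
move=> k2 kn.
have h1 := @bin_sub_le (n - 1) k (k - 2) ltac:(nia).
have h2 := @bin_sub_ge (n - 2) (k - 1) (k - 3) ltac:(nia).
have h3 := @bin_diag_le n k 2 k2 ltac:(nia).
move: h1 h2 h3.
have -> : (k - 2).+1 = k - 1 by lia.
have -> : (k - 3).+1 = k - 2 by lia.
have -> : n - 1 - k = n - k - 1 by lia.
have -> : n - 2 - (k - 1) = n - k - 1 by lia.
have -> : (n - 2).-1 = n - 3 by lia.
move: 'C(n - k - 1, k - 1) 'C(n - 1, k - 1) 'C(n - 2, k - 2) 'C(n - 3, k - 3) 'C(n - k - 1, k - 2).
move=> a b c d e h1 h2 h3.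
have h4 : 2 * k * d <= c.
  rewrite -(@leq_pmul2l k); last lia.
  apply: leq_trans h3; rewrite mulnA leq_mul2r; apply/orP; right; nia.
have : c <= 2 * e by nia.
nia.
Qed.

(** * Stars, links and meeting families *)

Lemma card_star_le (n k : nat) (F : {set {set 'I_n}}) (P : {set 'I_n}) :
  F \subset ksets n k -> #|star F P| <= 'C(n - #|P|, k - #|P|).
Proof.
move=> Fk.
have -> : n - #|P| = #|~: P| by rewrite [RHS]cardsCs setCK card_ord.
rewrite -cards_draws -(card_in_imset (f := fun A => A :\: P) (D := star F P)); last first.
  move=> A B; rewrite !inE => /andP[_ PA] /andP[_ PB] E.
  by rewrite -(setID A P) (setIidPr PA) E -{1}(setIidPr PB) setID.
apply: subset_leq_card; apply/subsetP => _ /imsetP[A + ->].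
rewrite !inE => /andP[AF PA]; rewrite subDset setUCr subsetT /=.
have := subsetP Fk _ AF; rewrite inE => /eqP <-.
by rewrite cardsD (setIidPr PA).
Qed.

Lemma card_link (n : nat) (F : {set {set 'I_n}}) (x : 'I_n) : #|link F [set x]| = #|star F [set x]|.
Proof.
have -> : link F [set x] = (fun A => A :\: [set x]) @: star F [set x].
  by apply/setP => B; apply/imsetP/imsetP => -[A hA ->]; exists A; rewrite // inE in hA *.
apply: card_in_imset => A B; rewrite !inE !sub1set => /andP[_ hA] /andP[_ hB] E.
by rewrite -(setD1K hA) -(setD1K hB) E.
Qed.

Lemma card_bigcup_le (I T : finType) (A : {set I}) (f : I -> {set T}) :
  #|\bigcup_(i in A) f i| <= \sum_(i in A) #|f i|.
Proof.
apply: (big_ind2 (fun (X : {set T}) m => #|X| <= m)) => //; first by rewrite cards0.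
move=> X a Y b hX hY; apply: leq_trans (leq_card_setU X Y) (leq_add hX hY).
Qed.

Lemma meeting_le_sum (n : nat) (E : {set {set 'I_n}}) (P : {set 'I_n}) :
  #|meeting E P| <= \sum_(x in P) #|star E [set x]|.
Proof.
apply: leq_trans _ (card_bigcup_le P (fun x => star E [set x])); apply: subset_leq_card; apply/subsetP => A.
rewrite inE => /andP[AE /set0Pn[x]]; rewrite inE => /andP[xA xP].
by apply/bigcupP; exists x; rewrite // inE AE sub1set.
Qed.

(** * Degrees and codegrees in a family of k-sets *)

Section Bounds.
Variables (n k : nat) (F : {set {set 'I_n}}).
Hypothesis Fk : F \subset ksets n k.

Lemma star_le_trace (A : {set 'I_n}) (x : 'I_n) : x \in A ->
  #|star F [set x]| <= #|trace F A x| + #|A| * 'C(n - 2, k - 2).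
Proof.
move=> xA; have sub : star F [set x] \subset
    trace F A x :|: \bigcup_(y in A :\ x) star F [set x; y].
  apply/subsetP => B; rewrite !inE sub1set => /andP[BF xB]; rewrite BF /=.
  have [//|ne] := eqVneq (B :&: A) [set x]; apply/bigcupP.
  have /subsetPn[y] : ~~ (B :&: A \subset [set x]).
    apply: contra ne => h; rewrite eqEsubset h sub1set inE xB; exact: xA.
  rewrite !inE => /andP[yB yA] yx; exists y; first by rewrite !inE yx.
  by rewrite inE BF subUset !sub1set xB.
apply: leq_trans (subset_leq_card sub) _.
apply: leq_trans (leq_card_setU _ _) _; rewrite leq_add2l.
apply: leq_trans (card_bigcup_le _ _) _.
apply: leq_trans (_ : #|A :\ x| * 'C(n - 2, k - 2) <= _).
  rewrite -sum_nat_const; apply: leq_sum => y; rewrite !inE => /andP[yx _].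
  by have := card_star_le [set x; y] Fk; rewrite cards2 eq_sym yx.
by rewrite leq_mul2r subset_leq_card ?orbT // subsetDl.
Qed.

Lemma sum_trace_le (A : {set 'I_n}) : \sum_(x in A) #|trace F A x| <= #|F|.
Proof.
under eq_bigr => x _ do rewrite /trace -sum1dep_card.
rewrite -sum1_card.
under eq_bigr => x _ do rewrite big_mkcondr /=.
rewrite exchange_big /=; apply: leq_sum => B BF.
case: (pickP (fun x => B :&: A == [set x])) => [x0 /eqP Ex0|none]; last first.
  by rewrite big1 // => x _; rewrite none.
rewrite Ex0 (eq_bigr (fun x => if x == x0 then 1 else 0)); last first.
  by move=> x _; rewrite (inj_eq set1_inj) eq_sym.
by rewrite -big_mkcondr sum1_card; apply: leq_trans (subset_leq_card (B := [set x0]) _) _;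
   [apply/subsetP => x; rewrite !inE => /andP[]|rewrite cards1].
Qed.

(** The traces at distinct points of [A] are disjoint subfamilies, and each star exceeds its trace
    only by members containing a second point of [A]. *)
Lemma bonferroni (A : {set 'I_n}) :
  \sum_(x in A) #|star F [set x]| <= #|F| + #|A| ^ 2 * 'C(n - 2, k - 2).
Proof.
apply: leq_trans _ (leq_add (sum_trace_le A) (leqnn _)).
rewrite expnS expn1 -mulnA -sum_nat_const -big_split /=.
by apply: leq_sum => x xA; apply: star_le_trace.
Qed.

(** * Spread subfamilies *)

Lemma exists_spread_star (r : nat) (G : {set {set 'I_n}}) :
  exists P : {set 'I_n}, #|G| <= r ^ #|P| * #|star G P| /\
    forall y, y \notin P -> r * #|star G (y |: P)| <= #|star G P|.
Proof.
pose ok (P : {set 'I_n}) := #|G| <= r ^ #|P| * #|star G P|.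
have ok0 : ok set0.
  rewrite /ok cards0 mul1n; apply: subset_leq_card.
  by apply/subsetP => A AG; rewrite inE AG sub0set.
(* If spreadness failed at [y], then [y |: P] would again satisfy [ok], against maximality. *)
case: (arg_maxnP (fun P : {set 'I_n} => #|P|) ok0) => P okP maxP.
exists P; split=> // y yP; rewrite leqNgt; apply/negP => lt.
suff /maxP : ok (y |: P) by rewrite /= cardsU1 yP add1n ltnn.
rewrite /ok cardsU1 yP add1n expnSr -mulnA; apply: leq_trans okP _.
by rewrite leq_mul2l (ltnW lt) orbT.
Qed.

(* A member of the spread family G[P] meets a fixed k-set disjoint from P with
   probability at most 1/(ct); so on average it meets, outside P, at most
   |F|/(ct) of the |F|/t members of F that it has to meet. *)
Lemma spread_degree (c t : nat) (G : {set {set 'I_n}}) (P : {set 'I_n}) :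
  0 < k -> {in F, forall A : {set 'I_n}, #|F| <= t * #|meeting F A|} -> G \subset F ->
  0 < #|star G P| ->
  (forall y, y \notin P -> c * t * k * #|star G (y |: P)| <= #|star G P|) ->
  c * #|F| <= c * t * (\sum_(x in P) #|star F [set x]|) + #|F|.
Proof.
move=> k0 Fdeg GF GP0 spread.
(* [X] counts pairs (A, B) where B misses P but meets A: [hX] sums over B first and uses spreadness,
   [hF] sums over A first and uses the degree hypothesis. *)
set X := \sum_(A in star G P) #|[set B in F | (B :&: P == set0) && (B :&: A != set0)]|.
have hX : c * t * k * X <= #|F| * (k * #|star G P|).
  rewrite /X; under eq_bigr => A _ do rewrite -sum1dep_card.
  under eq_bigr => A _ do rewrite big_mkcondr /=.
  rewrite exchange_big /= big_distrr /= -sum_nat_const; apply: leq_sum => B BF.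
  rewrite -big_mkcondr /=.
  have [BP|BP] := eqVneq (B :&: P) set0; last by rewrite big_pred0 ?muln0 // => A; rewrite andbF.
  rewrite /= sum1dep_card.
  have -> : #|[set A | (A \in star G P) && (B :&: A != set0)]| = #|meeting (star G P) B|.
    by apply: eq_card => A; rewrite !inE setIC.
  apply: leq_trans (_ : c * t * k * \sum_(y in B) #|star G (y |: P)| <= _).
    rewrite leq_mul2l; apply/orP; right; apply: leq_trans (meeting_le_sum _ _) _.
    apply: leq_sum => y _; apply: subset_leq_card; apply/subsetP => A.
    by rewrite !inE subUset -!andbA => /and3P[-> -> ->].
  have -> : k * #|star G P| = \sum_(y in B) #|star G P|.
    by have := subsetP Fk _ BF; rewrite inE sum_nat_const => /eqP ->.
  rewrite big_distrr /=; apply: leq_sum => y yB; apply: spread.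
  by apply/negP => yP; have := in_set0 y; rewrite -BP inE yB yP.
have hF : #|star G P| * #|F| <= t * (#|star G P| * #|meeting F P| + X).
  rewrite -!sum_nat_const -big_split big_distrr /=; apply: leq_sum => A.
  rewrite inE => /andP[/(subsetP GF) AF _]; apply: leq_trans (Fdeg A AF) _.
  rewrite leq_mul2l; apply/orP; right.
  apply: leq_trans _ (leq_card_setU _ _); apply: subset_leq_card; apply/subsetP => B.
  by rewrite !inE => /andP[-> ->] /=; rewrite andbT orNb.
have {}hX : c * t * X <= #|F| * #|star G P|.
  by rewrite -(@leq_pmul2l k) //; lia.
rewrite -(@leq_pmul2l #|star G P|) //.
have hs : c * t * #|meeting F P| <= c * t * \sum_(x in P) #|star F [set x]|.
  by rewrite leq_mul2l meeting_le_sum orbT.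
nia.
Qed.

Lemma concentrated_star (t : nat) (G : {set {set 'I_n}}) :
  0 < t -> 3 < k -> 16 * t ^ 2 * k ^ 2 <= n ->
  {in F, forall A : {set 'I_n}, #|F| <= t * #|meeting F A|} -> G \subset F ->
  'C(n - 4, k - 4) < #|G| ->
  exists P : {set 'I_n}, [/\ 0 < #|star G P|, 2 ^ #|P| < (16 * t ^ 2 * k) ^ 4 &
    8 * t * #|F| <= 8 * t ^ 2 * (\sum_(x in P) #|star F [set x]|) + #|F|].
Proof.
move=> t0 k3 kn Fdeg GF ltG.
have Gk : G \subset ksets n k := subset_trans GF Fk.
(* This is the factor [c * t * k] of [spread_degree] for c = 8t; moreover 2rk = 16t^2k^2 is at most
   n. *)
set r := 8 * t * t * k.
have [P [GP spread]] := exists_spread_star r G.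
have GP0 : 0 < #|star G P| by rewrite lt0n; apply: contraTneq GP => ->; rewrite muln0; lia.
exists P; split=> //; last first.
  have := spread_degree (c := 8 * t) (t := t) (ltac:(lia)) Fdeg GF GP0 spread.
  by rewrite -[8 * t * t]mulnA mulnn.
have Pk : #|P| <= k.
  have /card_gt0P[A] := GP0; rewrite inE => /andP[AG PA].
  by have := subsetP Gk _ AG; rewrite inE => /eqP <-; apply: subset_leq_card.
have {}GP : #|G| <= r ^ #|P| * 'C(n - #|P|, k - #|P|).
  by apply: leq_trans GP _; rewrite leq_mul2l (card_star_le _ Gk) orbT.
have -> : 16 * t ^ 2 * k = 2 * r by rewrite /r; lia.
have r2 : 2 <= r by rewrite /r; nia.
rewrite expnMn.
(* Beyond 4, each element of P costs a factor 2r in the size of a full star but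
   gains only r in the spread estimate, so |P| is logarithmic in r. *)
have [p4|p4] := leqP #|P| 4.
  have h1 : 2 ^ #|P| <= 2 ^ 4 by rewrite leq_exp2l.
  have h2 : 2 ^ 4 <= r ^ 4 by rewrite leq_exp2r.
  nia.
have Ep : #|P| = 4 + (#|P| - 4) by lia.
move: (#|P| - 4) Ep => i Ep; rewrite Ep in GP Pk *.
have := @bin_diag_iter n k 4 i (2 * r) Pk ltac:(lia) ltac:(nia) ltac:(rewrite /r; nia).
move: GP; set b := 'C(_, _) => GP h.
(* The left side is at most ['C(n - 4, k - 4)], which is less than |G|. Cancelling leaves 2^i <
   r^4. *)
have : (2 * r) ^ i * b < r ^ (4 + i) * b by lia.
rewrite ltn_mul2r => /andP[_]; rewrite expnMn [r ^ (4 + _)]expnD ltn_mul2r => /andP[_ lt].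
by rewrite expnD ltn_mul2l.
Qed.

(** * Elements of large degree *)

Lemma card_heavy_lt (M : {set 'I_n}) (a c j : nat) :
  (forall x, x \in M -> a * #|F| <= c * #|star F [set x]|) ->
  c * (#|F| + j ^ 2 * 'C(n - 2, k - 2)) < j * (a * #|F|) -> #|M| < j.
Proof.
move=> heavy lt; rewrite ltnNge; apply/negP => /card_geqP[s [us ss sM]].
have cs : #|[set x in s]| = j by rewrite cardsE (card_uniqP us).
move: lt; rewrite ltnNge => /negP; apply.
have := bonferroni [set x in s]; rewrite cs => h.
apply: leq_trans (leq_mul (leqnn c) h); rewrite -{1}cs -sum_nat_const big_distrr /=.
by apply: leq_sum => x; rewrite inE => /sM; apply: heavy.
Qed.

Lemma heavy_elements (t m : nat) :
  0 < t -> 0 < m -> 3 < k -> 16 * t ^ 2 * k ^ 2 <= n ->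
  16 * m ^ 2 <= k -> 16 * t ^ 2 * t.+1 ^ 2 <= k ->
  (forall p, 2 ^ p < (16 * t ^ 2 * k) ^ 4 -> 8 * t ^ 2 * p <= m) ->
  0 < #|F| -> k * 'C(n - 2, k - 2) <= 2 * #|F| ->
  {in F, forall A : {set 'I_n}, #|F| <= t * #|meeting F A|} ->
  let M := [set x | #|F| <= m * #|star F [set x]|] in
  #|M| <= t /\ #|avoiding F M| <= 'C(n - 4, k - 4).
Proof.
move=> t0 m0 k3 kn mk tk pm F0 Fb Fdeg M.
have b42 : 'C(n - 4, k - 4) <= 'C(n - 2, k - 2).
  by have := @bin_diag_iter n k 2 2 1 k3 ltac:(lia) ltac:(nia) ltac:(nia); rewrite exp1n mul1n.
have b0 : 0 < 'C(n - 2, k - 2) by rewrite bin_gt0; nia.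
(* Outside [M] degrees are below |F|/m, and [pm] makes |P|/m at most 1/(8t^2). *)
have light (P Q : {set 'I_n}) : 2 ^ #|P| < (16 * t ^ 2 * k) ^ 4 -> Q \subset P ->
    [disjoint Q & M] -> 8 * t ^ 2 * (\sum_(x in Q) #|star F [set x]|) <= #|F|.
  move=> /pm Pm QP QM; rewrite -(@leq_pmul2l m) //.
  have h : m * (\sum_(x in Q) #|star F [set x]|) <= #|P| * #|F|.
    apply: leq_trans (_ : #|Q| * #|F| <= _); last by rewrite leq_mul2r subset_leq_card ?orbT.
    rewrite big_distrr -sum_nat_const; apply: leq_sum => x xQ.
    have := disjointFr QM xQ; rewrite inE => /negbT; rewrite -ltnNge; exact: ltnW.
  nia.
(* This crude bound keeps the codegree loss in [star_le_trace] small, so that each trace at a point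
   of [M] is large. *)
have M2 : #|M| < 2 * m.
  apply: (@card_heavy_lt M 1 m) => [x|]; first by rewrite inE mul1n.
  move: b0 Fb F0; set b := 'C(_, _); set f := #|_| => b0 Fb F0.
  have : 16 * m ^ 2 * b <= 2 * f by apply: leq_trans Fb; rewrite leq_mul2r mk orbT.
  move=> h; have : (2 * m) ^ 2 * b < f by rewrite expnMn; lia.
  nia.
split; last first.
  rewrite leqNgt; apply/negP => lt.
  have sub : avoiding F M \subset F by apply/subsetP => A; rewrite inE => /andP[].
  have [P [/card_gt0P[A]]] := concentrated_star t0 k3 kn Fdeg sub lt.
  rewrite !inE -andbA => /and3P[AF AM PA] Plt.
  have := light P P Plt (subxx _); rewrite (disjointWl PA) //; first by nia.
  by rewrite -setI_eq0.
(* Of the 8t in [concentrated_star], one unit is lost there and one to [light]. Since (t+1)(8t-2) =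
   8t^2 + 6t - 2 exceeds 8t^2 + 1, t+1 such elements are too many. *)
rewrite -ltnS; apply: (@card_heavy_lt M (8 * t - 2) (8 * t ^ 2)) => [x xM|]; last first.
  move: b0 Fb F0; set b := 'C(_, _); set f := #|_| => b0 Fb F0.
  have : 16 * t ^ 2 * t.+1 ^ 2 * b <= 2 * f by apply: leq_trans Fb; rewrite leq_mul2r tk orbT.
  have -> : t.+1 * ((8 * t - 2) * f) = 8 * t ^ 2 * f + (6 * t - 2) * f by nia.
  have : 2 * f <= (6 * t - 2) * f by rewrite leq_mul2r; apply/orP; right; lia.
  rewrite mulnDr !mulnA; lia.
have sub : trace F M x \subset F by apply/subsetP => A; rewrite inE => /andP[].
have lt : 'C(n - 4, k - 4) < #|trace F M x|.
  apply: leq_ltn_trans b42 _.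
  have := star_le_trace xM; move: xM; rewrite inE.
  move: b0 Fb F0; set b := 'C(_, _); set f := #|F| => b0 Fb F0.
  have h : 16 * m ^ 2 * b <= 2 * f by apply: leq_trans Fb; rewrite leq_mul2r mk orbT.
  move=> h1 h2.
  have h3 : #|M| * b <= 2 * m * b by rewrite leq_mul2r (ltnW M2) orbT.
  rewrite -(@ltn_pmul2l m) //.
  have h4 : f <= m * #|trace F M x| + m * (2 * m * b).
    apply: leq_trans h1 _; rewrite -mulnDr leq_mul2l; apply/orP; right.
    by apply: leq_trans h2 _; rewrite leq_add2l.
  have h5 : m * b <= m ^ 2 * b by rewrite leq_mul2r -{1}(expn1 m) leq_pexp2l ?orbT.
  have h6 : 0 < m * b by rewrite muln_gt0 m0.
  lia.
have [P [/card_gt0P[A]]] := concentrated_star t0 k3 kn Fdeg sub lt.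
rewrite !inE -andbA => /and3P[AF /eqP AM PA] Plt.
(* As P lies in a set A with A :&: M = {x}, removing x makes it disjoint from [M]. *)
have := light P (P :\ x) Plt (subsetDl _ _).
have -> : [disjoint P :\ x & M].
  rewrite -setI_eq0; apply/eqP/setP => y; rewrite !inE; apply/negP => /andP[/andP[yx yP] yM].
  case/negP: yx; have : y \in A :&: M by rewrite !inE (subsetP PA).
  by rewrite AM inE.
move/(_ isT) => h1 h2.
have : \sum_(y in P) #|star F [set y]| <=
    #|star F [set x]| + \sum_(y in P :\ x) #|star F [set y]|.
  have [xP|xP] := boolP (x \in P); first by rewrite (big_setD1 x).
  rewrite -[X in X <= _]add0n leq_add //.
  by rewrite (setDidPl _) // disjoint_sym disjoints1.
move: (\sum_(y in P) _) (\sum_(y in P :\ x) _) h1 h2 => X Y h1 h2 h3.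
nia.
Qed.
End Bounds.

(** * Choice of the threshold and conclusion *)

Lemma parameters (t : nat) : 0 < t -> exists k0, forall k, k0 <= k -> exists m,
  [/\ 0 < m, 16 * m ^ 2 <= k &
     forall p, 2 ^ p < (16 * t ^ 2 * k) ^ 4 -> 8 * t ^ 2 * p <= m].
Proof.
move=> t0; have [j0 hj0] := linear_le_exp2 (256 * t ^ 2) (32 * t ^ 2 * (8 * t + 24)).
exists (4 ^ (j0 + 2)) => k hk.
have k0 : 0 < k by apply: leq_trans hk; rewrite expn_gt0.
have hT := @trunc_log_bounds 4 k isT k0.
have : j0 + 2 <= trunc_log 4 k by apply: trunc_log_max.
(* With 4^T <= k < 4^(T+1), this m satisfies 16m^2 = 4^T, while the admissible p are only linear in
   T. *)
move: (trunc_log 4 k) hT => T /andP[Tk kT] jT; exists (2 ^ (T - 2)).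
have E : T = (T - 2) + 2 by lia.
rewrite expn_gt0; split=> //.
  apply: leq_trans Tk; rewrite [in leqRHS]E expnD -expnM.
  by rewrite [(T - 2) * 2]mulnC expnM mulnC.
move=> p hp.
have : p < 8 * T + 8 * t + 24.
  rewrite -(@ltn_exp2l 2) //; apply: leq_trans hp _.
  have -> : 8 * T + 8 * t + 24 = (4 + t * 2 + 2 * T.+1) * 4 by lia.
  rewrite expnM leq_exp2r // !expnD (expnM 2 t 2) (expnM 2 2).
  apply: leq_mul (ltnW kT); apply: leq_mul => //.
  by rewrite leq_exp2r // ltnW // ltn_expl.
have := hj0 T ltac:(lia); rewrite {2}E expnD.
move: (2 ^ (T - 2)) => m; nia.
Qed.

(** Every member of [F] either meets [A] or is a Kneser neighbour of [A]. *)
Lemma meeting_ge (n k t : nat) (F : {set {set 'I_n}}) :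
  F \subset ksets n k -> t * induced_max_degree (kneser n k) F < (t - 1) * #|F| ->
  {in F, forall A : {set 'I_n}, #|F| <= t * #|meeting F A|}.
Proof.
move=> Fk lt A AF.
have hd : #|[set B in F | kneser n k A B]| <= induced_max_degree (kneser n k) F.
  exact: (@leq_bigmax_cond _ (mem F) (fun C => #|[set B in F | kneser n k C B]|)).
have : #|F| <= #|meeting F A| + #|[set B in F | kneser n k A B]|.
  apply: leq_trans _ (leq_card_setU _ _); apply: subset_leq_card; apply/subsetP => B BF.
  rewrite !inE BF /kneser !(subsetP Fk) //= -setI_eq0 setIC; exact: orNb.
nia.
Qed.

Local Open Scope ring_scope.

Theorem theorem3 (t : nat) (ht : (2 <= t)%N) :
  exists k0 : nat,
    forall (R : rcfType) (k n : nat) (F : {set {set 'I_n}}),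
      (k0 <= k)%N ->
      (16 * t ^ 2 * k ^ 2 <= n)%N ->
      F \subset ksets n k ->
      ('C(n - 1, k - 1) - 'C(n - k - 1, k - 1) + 2 <= #|F|)%N ->
      (1 - t%:R^-1) * #|F|%:R <= (induced_max_degree (kneser n k) F)%:R :> R
      \/ exists S : {set 'I_n},
           [/\ (#|S| <= t)%N,
               (#|avoiding F S| <= 'C(n - 4, k - 4))%N
             & forall x : 'I_n, x \in S ->
                 (Num.sqrt k%:R)^-1 * #|F|%:R <= #|link F [set x]|%:R :> R].
Proof.
have t0 : (0 < t)%N by lia.
have [k0 hk0] := parameters t0.
exists (k0 + 16 * t ^ 2 * t.+1 ^ 2 + 4)%N => R k n F hk kn Fk Fsize.
have [hd|hd] := leqP ((t - 1) * #|F|) (t * induced_max_degree (kneser n k) F).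
  left; rewrite -(@ler_pM2l R t%:R) ?ltr0n // mulrA mulrBr mulr1 divff ?pnatr_eq0 -?lt0n //.
  by rewrite -(natrB R t0) -!natrM ler_nat.
right; have [m [m0 mk pm]] := hk0 k ltac:(lia).
have Fb : (k * 'C(n - 2, k - 2) <= 2 * #|F|)%N.
  apply: leq_trans (size_bound (n := n) (k := k) _ _) _; [lia|nia|lia].
have [M1 M2] := heavy_elements Fk t0 m0 ltac:(lia) kn mk ltac:(lia) pm ltac:(lia) Fb
  (meeting_ge Fk hd).
exists [set x | (#|F| <= m * #|star F [set x]|)%N]; split=> // x.
have k0' : (0 < k)%N by lia.
(* The threshold 1/m suffices because m^2 <= k. *)
rewrite inE card_link mulrC ler_pdivrMr ?sqrtr_gt0 ?ltr0n // -(ler_nat R) => /le_trans; apply.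
rewrite natrM mulrC ler_wpM2l // -(@ler_pXn2r R 2) ?nnegrE ?sqrtr_ge0 //.
by rewrite sqr_sqrtr // -natrX ler_nat; lia.
Qed.
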